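(* Let $\alpha=[a_1,\ldots,a_{2t}]\in P(X)$, set $a_{2t+1}:=+\infty$ and $i:=\min\{k\ge 2: a_k+1<a_{k+1}\}$. If $i<2t-1$, then the natural generators of $I_\alpha(X)$, i.e. the Pfaffians $\beta\in P(X)$ with $\beta\not\geq\alpha$, are not a Gröbner basis of $I_\alpha(X)$ with respect to the fixed anti-diagonal term order on $R$.
   Context: Let $K$ be a field, $X=(X_{ij})$ a skew-symmetric $n\times n$ matrix of indeterminates, and $R=K[X]=K[X_{ij}: 1\le i<j\le n]$. For $1\le a_1<\dots<a_{2t}\le n$, $[a_1,\ldots,a_{2t}]$ denotes the Pfaffian of the skew-symmetric submatrix of $X$ with row and column indices $a_1,\ldots,a_{2t}$; it is said to have size $2t$. $P(X)$ is the set of all Pfaffians of $X$, partially ordered by: $[a_1,\ldots,a_{2t}]\le[b_1,\ldots,b_{2s}]$ iff $t\ge s$ and $a_i\le b_i$ for $i=1,\ldots,2s$. The ideal cogenerated by $\alpha\in P(X)$ is $I_\alpha(X)=(\beta\in P(X): \beta\not\ge\alpha)\subset R$. A term order on $R$ is anti-diagonal if the initial monomial of every Pfaffian $[a_1,\ldots,a_{2t}]$ is $X_{a_1a_{2t}}X_{a_2a_{2t-1}}\cdots X_{a_ta_{t+1}}$. Throughout, an arbitrary anti-diagonal term order on $R$ is fixed. *)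

(* Defs.v *)
From HB Require Import structures.
From mathcomp Require Import all_boot all_order all_fingroup all_algebra.
From mathcomp.multinomials Require Import mpoly.

Set Implicit Arguments.
Unset Strict Implicit.
Unset Printing Implicit Defensive.

Import GRing.Theory.
Local Open Scope ring_scope.

(* The Pfaffian of A : 'M_(2t) is the sum over the perfect matchings
   {s 0, s 1}, ..., {s (2t-2), s (2t-1)} of {0, ..., 2t-1}, each taken once:
   its edges are written increasingly and sorted by their left ends.  This
   form involves no division, so it is valid in every characteristic. *)
Section Pfaffian.

Variable t : nat.

Lemma lft_subproof (k : 'I_t) : (k.*2 < t.*2)%N.
Proof. by rewrite ltn_double. Qed.

Lemma rgt_subproof (k : 'I_t) : (k.*2.+1 < t.*2)%N.
Proof. by rewrite ltn_Sdouble. Qed.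

Definition lft (k : 'I_t) : 'I_(t.*2) := Ordinal (lft_subproof k).
Definition rgt (k : 'I_t) : 'I_(t.*2) := Ordinal (rgt_subproof k).

Definition matching_perm (s : 'S_(t.*2)) : bool :=
  [forall k : 'I_t, (s (lft k) < s (rgt k))%N] &&
  [forall k : 'I_t, forall l : 'I_t,
    (k < l)%N ==> (s (lft k) < s (lft l))%N].

Definition pfaffian (R : pzRingType) (A : 'M[R]_(t.*2)) : R :=
  \sum_(s : 'S_(t.*2) | matching_perm s)
    (-1) ^+ s * \prod_(k < t) A (s (lft k)) (s (rgt k)).

End Pfaffian.

(* The indeterminates X_ij, i < j, are the 'X_v for v : 'I_(nvars n), where
   v runs through the enumeration of the pairs i < j. *)
Definition upair (n : nat) := {p : 'I_n * 'I_n | (p.1 < p.2)%N}.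

Definition nvars (n : nat) : nat := #|{: upair n}|.

Notation pfring K n := {mpoly K[nvars n]}.

Section Pfaffians.

Variables (K : fieldType) (n : nat).

Definition indet (u : upair n) : pfring K n := 'X_(enum_rank u).

Definition skewX : 'M[pfring K n]_n :=
  \matrix_(i, j)
    if insub (i, j) is Some u then indet u
    else if insub (j, i) is Some u then - indet u
    else 0.

(* An element of P(X) is represented by its sequence of indices
   a_1 < ... < a_2t, which are 0-based: tnth a k is a_(k+1) - 1. *)
Definition pf_index (t : nat) (a : (t.*2).-tuple 'I_n) : bool :=
  (0 < t)%N && sorted ltn [seq val x | x <- a].

Definition pf (t : nat) (a : (t.*2).-tuple 'I_n) : pfring K n :=
  pfaffian (mxsub (tnth a) (tnth a) skewX).

(* entry a k is the k-th index of a, with k counted from 1; it is only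
   meaningful for 1 <= k <= 2t. *)
Definition entry (t : nat) (a : (t.*2).-tuple 'I_n) (k : nat) : nat :=
  nth 0%N [seq val x | x <- a] k.-1.

Definition pf_le (t s : nat) (a : (t.*2).-tuple 'I_n)
    (b : (s.*2).-tuple 'I_n) : Prop :=
  (s <= t)%N /\
  forall k : nat, (1 <= k <= s.*2)%N -> (entry a k <= entry b k)%N.

Definition cogen (t : nat) (a : (t.*2).-tuple 'I_n) (f : pfring K n) : Prop :=
  exists (s : nat) (b : (s.*2).-tuple 'I_n),
    [/\ pf_index b, ~ pf_le a b & f = pf b].

(* a_k + 1 < a_(k+1), with the convention a_(2t+1) = +oo *)
Definition gap (t : nat) (a : (t.*2).-tuple 'I_n) (k : nat) : bool :=
  (k <= t.*2)%N &&
  ((k == t.*2) || ((entry a k).+1 < entry a k.+1)%N).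

Definition is_first_gap (t : nat) (a : (t.*2).-tuple 'I_n) (i : nat) : Prop :=
  [/\ (2 <= i)%N, gap a i & forall k : nat, (2 <= k)%N -> gap a k -> (i <= k)%N].

End Pfaffians.

Section Groebner.

Variables (K : fieldType) (N : nat).
Implicit Types (le : rel 'X_{1..N}) (S I : {mpoly K[N]} -> Prop).

Definition ideal_gen S (f : {mpoly K[N]}) : Prop :=
  exists r : seq ({mpoly K[N]} * {mpoly K[N]}),
    (forall cg, cg \in r -> S cg.2) /\ f = \sum_(cg <- r) cg.1 * cg.2.

Definition term_order le : Prop :=
  [/\ total le, antisymmetric le, transitive le,
      forall m, le 0%MM m &
      forall m m1 m2, le m1 m2 -> le (m + m1)%MM (m + m2)%MM].

Definition is_initial le (f : {mpoly K[N]}) (m : 'X_{1..N}) : Prop :=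
  m \in msupp f /\ forall m', m' \in msupp f -> le m' m.

(* 0 has no initial monomial, so only the nonzero elements of S count. *)
Definition initial_ideal le S : {mpoly K[N]} -> Prop :=
  ideal_gen (fun q => exists f m, [/\ S f, is_initial le f m & q = 'X_[m]]).

Definition groebner_basis le S I : Prop :=
  (forall g, S g -> I g) /\
  (forall q, initial_ideal le S q <-> initial_ideal le I q).

End Groebner.

Section AntiDiagonal.

Variables (K : fieldType) (n : nat).

Lemma half_subproof (t : nat) : (t <= t.*2)%N.
Proof. by rewrite -addnn leq_addr. Qed.

(* X_(a_1 a_2t) X_(a_2 a_(2t-1)) ... X_(a_t a_(t+1)) *)
Definition antidiag (t : nat) (a : (t.*2).-tuple 'I_n) : pfring K n :=
  \prod_(k < t) let l := widen_ord (half_subproof t) k in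
    skewX K n (tnth a l) (tnth a (rev_ord l)).

Definition anti_diagonal (le : rel 'X_{1..nvars n}) : Prop :=
  forall (t : nat) (a : (t.*2).-tuple 'I_n), pf_index a ->
    exists2 m, is_initial le (pf K a) m & 'X_[m] = antidiag a.

End AntiDiagonal.

(* Main.v *)
Require Import Defs.
From mathcomp Require Import all_boot all_order all_fingroup all_algebra.
From mathcomp.multinomials Require Import mpoly.
From mathcomp Require Import zify ring.

(* Let d = 0 if i is even and d = 1 if i is odd, and set 2s = i + 2 + d <= 2t.
   Insert c = a_i + 1 < a_(i+1) into a_1, .., a_2s after a_i, and number the
   resulting increasing sequence Z as z_0 < .. < z_2s.  The Pfaffian with
   indices z_d, z_0, .., z_2s has a repeated index, hence it vanishes;
   expanding it along its first row gives
     sum_j (-1)^j X_(z_d z_j) [Z \ z_j] = 0.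
   The terms with z_j > c lie in the cogenerated ideal, because the (i+1)-st
   index of [Z \ z_j] is then c < a_(i+1).  So the remaining part F of the sum
   lies in the ideal as well.  Its terms have distinct initial monomials,
   hence the largest of these is the initial monomial of F.

   None of them is divisible by the initial monomial of a natural generator
   [b_1, .., b_2s']: divisibility forces all the b_k to be in Z, and then
   some b_k < a_k forces b_1, .., b_(i+1) = a_1, .., a_i, c, so that c is
   paired with z_p, where p = 2s' - 1 - i <= 1 + d and p <> d by parity.  But
   in the term of F of index j, c is paired with z_d or with an index that
   exceeds z_(1+d). *)

Set Implicit Arguments.
Unset Strict Implicit.
Unset Printing Implicit Defensive.

Import GRing.Theory.
Local Open Scope ring_scope.

(** * Lifting of permutations and expansion of a Pfaffian along its first row *)

Lemma lift_perm_surj n (i j : 'I_n.+1) (s : 'S_n.+1) :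
  s i = j -> exists s', s = lift_perm i j s'.
Proof.
move=> sij; pose f k := odflt k (unlift j (s (lift i k))).
have fE k : lift j (f k) = s (lift i k).
  rewrite /f; case: unliftP => [l -> //|]; rewrite -sij => /perm_inj /eqP.
  by rewrite eq_sym (negPf (neq_lift _ _)).
have f_inj : injective f.
  by move=> k l /(congr1 (lift j)); rewrite !fE => /perm_inj /lift_inj.
exists (perm f_inj); apply/permP=> k; case: (unliftP i k) => [l ->|->].
  by rewrite lift_perm_lift permE fE.
by rewrite lift_perm_id.
Qed.

Lemma lift_perm_inj n (i j : 'I_n.+1) : injective (lift_perm i j).
Proof.
move=> s s' /permP ss'; apply/permP=> k; have := ss' (lift i k).
by rewrite !lift_perm_lift => /lift_inj.
Qed.

Lemma ltn_lift n (h : 'I_n.+1) (i j : 'I_n) : (lift h i < lift h j)%N = (i < j)%N.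
Proof. by rewrite /= !ltnNge leq_bump2. Qed.

Section Expansion.

Variable t : nat.

(** If [p.2] encodes a matching, this encodes the one that pairs 0 with [p.1 + 1] and matches the
    remaining points as [p.2] does. *)
Definition expand_perm (p : 'I_t.*2.+1 * 'S_(t.*2)) : 'S_(t.+1.*2) :=
  @lift_perm t.*2.+1 ord0 ord0 (lift_perm ord0 p.1 p.2).

Lemma lft0 : lft (ord0 : 'I_t.+1) = ord0. Proof. exact: val_inj. Qed.
Lemma rgt0 : rgt (ord0 : 'I_t.+1) = lift ord0 ord0. Proof. exact: val_inj. Qed.
Lemma lft_lift (k : 'I_t) : lft (lift ord0 k) = lift ord0 (lift ord0 (lft k)).
Proof. exact: val_inj. Qed.
Lemma rgt_lift (k : 'I_t) : rgt (lift ord0 k) = lift ord0 (lift ord0 (rgt k)).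
Proof. exact: val_inj. Qed.

Lemma expand_perm_lft0 p : expand_perm p (lft ord0) = ord0.
Proof. by rewrite lft0 lift_perm_id. Qed.

Lemma expand_perm_rgt0 p : expand_perm p (rgt ord0) = lift ord0 p.1.
Proof. by rewrite rgt0 /expand_perm lift_perm_lift lift_perm_id. Qed.

Lemma expand_perm_lft p k :
  expand_perm p (lft (lift ord0 k)) = lift ord0 (lift p.1 (p.2 (lft k))).
Proof. by rewrite lft_lift /expand_perm !lift_perm_lift. Qed.

Lemma expand_perm_rgt p k :
  expand_perm p (rgt (lift ord0 k)) = lift ord0 (lift p.1 (p.2 (rgt k))).
Proof. by rewrite rgt_lift /expand_perm !lift_perm_lift. Qed.

Definition expand_permE :=
  (expand_perm_lft0, expand_perm_rgt0, expand_perm_lft, expand_perm_rgt).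

Lemma expand_perm_inj : injective expand_perm.
Proof.
move=> [j s] [j' s'] E; have Ej : j = j'.
  have := congr1 (fun u : 'S__ => u (rgt ord0)) E.
  by rewrite /= !expand_permE => /lift_inj.
by move: E; rewrite Ej => /lift_perm_inj /lift_perm_inj /= ->.
Qed.

Lemma matching_expand_perm p : matching_perm (expand_perm p) = matching_perm p.2.
Proof.
congr andb.
  apply/forallP/forallP=> H k; first by have := H (lift ord0 k); rewrite !expand_permE !ltn_lift.
  by case: (unliftP ord0 k) => [l ->|->]; rewrite !expand_permE // !ltn_lift.
apply/forallP/forallP=> H k.
  apply/forallP=> l; have /forallP/(_ (lift ord0 l)) := H (lift ord0 k).
  by rewrite !expand_permE !ltn_lift.
apply/forallP=> l; case: (unliftP ord0 l) => [l' ->|-> //].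
case: (unliftP ord0 k) => [k' ->|->]; rewrite !expand_permE // !ltn_lift.
by have /forallP := H k'; apply.
Qed.

(** The value 0 cannot be a right end, which exceeds its left end; and the left ends increase, so 0
    is the first of them. *)
Lemma matching_perm0 (s : 'S_(t.+1.*2)) : matching_perm s -> s ord0 = ord0.
Proof.
case/andP=> /forallP sE /forallP sL; rewrite -lft0.
have lf k : (s (lft ord0) <= s (lft k))%N.
  case: (unliftP ord0 k) => [l ->|-> //].
  by have /forallP/(_ (lift ord0 l)) := sL ord0 => /= /ltnW.
pose k := (s^-1)%g (ord0 : 'I_(t.+1.*2)).
have sk : s k = ord0 by rewrite permKV.
have hk : (k./2 < t.+1)%N by rewrite ltn_half_double.
apply: val_inj; apply/eqP; rewrite -leqn0 /=.
case: (boolP (odd k)) => ok.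
  have kE : k = rgt (Ordinal hk).
    by apply: val_inj; rewrite /= -[LHS](odd_double_half k) ok.
  have := sE (Ordinal hk); rewrite -kE sk; by [].
have kE : k = lft (Ordinal hk).
  by apply: val_inj; rewrite /= -[LHS](odd_double_half k) (negPf ok).
by have := lf (Ordinal hk); rewrite -kE sk.
Qed.

Lemma matching_perm_expand (s : 'S_(t.+1.*2)) :
  matching_perm s -> exists p, s = expand_perm p.
Proof.
move/matching_perm0=> s0.
have [s1 s1E] := @lift_perm_surj t.*2.+1 ord0 ord0 s s0.
have [s2 s2E] := @lift_perm_surj t.*2 ord0 (s1 ord0) s1 erefl.
by exists (s1 ord0, s2); rewrite s1E {1}s2E.
Qed.

(** The matchings are sorted by the partner [j + 1] of 0; the two liftings contribute the sign
    [(-1) ^+ j]. *)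
Lemma pfaffian_expand (R : comPzRingType) (A : 'M[R]_(t.+1.*2)) :
  pfaffian A = \sum_(j < t.*2.+1) (-1) ^+ j * (A ord0 (lift ord0 j) *
    pfaffian (mxsub (fun k => lift ord0 (lift j k))
                    (fun k => lift ord0 (lift j k)) A)).
Proof.
pose M := [set p : 'I_t.*2.+1 * 'S_(t.*2) | matching_perm p.2].
rewrite /pfaffian (eq_bigl (mem [set expand_perm p | p in M])); last first.
  move=> s; apply/idP/imsetP => [ms|[p]]; last first.
    by rewrite inE => mp ->; rewrite matching_expand_perm.
  have [p sE] := matching_perm_expand ms; exists p => //.
  by rewrite inE -matching_expand_perm -sE.
rewrite big_imset /=; last by move=> p q _ _; apply: expand_perm_inj.
under [RHS]eq_bigr => j _ do rewrite mulr_sumr mulr_sumr.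
rewrite pair_big_dep /=; apply: eq_big => [p|p _]; first by rewrite inE.
rewrite big_ord_recl !expand_permE /expand_perm !odd_lift_perm /= signr_addb.
rewrite signr_odd; under eq_bigr => k _ do rewrite !expand_permE.
rewrite -!mulrA; congr (_ * _); rewrite mulrCA; congr (_ * (_ * _)).
by apply: eq_bigr => k _; rewrite mxE.
Qed.

End Expansion.

(** * Vanishing of Pfaffians with a repeated index *)

Section RepeatedIndex.

Variables (T : Type) (R : comPzRingType) (A : T -> T -> R).
Hypotheses (A0 : forall x, A x x = 0) (AN : forall x y, A x y = - A y x).
Implicit Types (x y : T) (z : nat -> T).

(** Indices may repeat, and [z] lives on all naturals, so that deleting index [j] is composition
    with [bump j]. *)
Definition pfz s z : R := pfaffian (\matrix_(i < s.*2, j < s.*2) A (z i) (z j)).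

Lemma eq_pfz s z z' : (forall k, k < s.*2 -> z k = z' k)%N -> pfz s z = pfz s z'.
Proof.
by move=> zz'; congr pfaffian; apply/matrixP=> i j; rewrite !mxE !zz'.
Qed.

Lemma pfz_expand s z : pfz s.+1 z = \sum_(j < s.*2.+1)
  (-1) ^+ j * (A (z 0) (z j.+1) * pfz s (fun k => z (bump j k).+1)).
Proof.
rewrite /pfz pfaffian_expand; apply: eq_bigr => j _.
rewrite !mxE lift0; congr (_ * (_ * pfaffian _)).
by apply/matrixP=> k l; rewrite !mxE !lift0.
Qed.

(** Up to sign, a term of the Pfaffian of x, y, z_0, z_1, .. expanded twice: x is paired with z_j,
    then y with the k-th remaining index. *)
Definition pair_term x y s z j k : R :=
  (-1) ^+ (j + k) * (A x (z j) * (A y (z (bump j k)) *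
    pfz s (fun l => z (bump j (bump k l))))).

Definition pair_sum x y s z : R :=
  \sum_(j < s.*2.+2) \sum_(k < s.*2.+1) pair_term x y s z j k.

Definition half_pair_sum x y s z : R :=
  \sum_(k < s.*2.+1) \sum_(j < s.*2.+1 | (j <= k)%N) pair_term x y s z j k.

(** Both sides pair x with z_(j+1) and y with z_k. Removing z_k first lowers the other position by
    one, whence the sign. *)
Lemma pair_termN x y s z j k :
  (k <= j)%N -> pair_term x y s z j.+1 k = - pair_term y x s z k j.
Proof.
move=> kj; rewrite /pair_term addSn exprS mulN1r mulNr addnC.
have -> : bump j.+1 k = k by rewrite /bump ltnNge kj.
have -> : bump k j = j.+1 by rewrite /bump kj.
rewrite [A x _ * _]mulrCA; congr (- (_ * (_ * (_ * _)))).
apply: eq_pfz => l _; congr z; rewrite /bump; lia.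
Qed.

(** [half_pair_sum] collects the terms where the partner of x precedes that of y; [pair_termN]
    handles the others. Vanishing for x = y thus follows in characteristic 2 too. *)
Lemma pair_sumE x y s z :
  pair_sum x y s z = half_pair_sum x y s z - half_pair_sum y x s z.
Proof.
rewrite /pair_sum; under eq_bigr => j _ do
  rewrite (bigID (fun k : 'I__ => (j <= k)%N)) /=.
rewrite big_split /=; congr (_ + _).
  rewrite [LHS](exchange_big_dep predT) //=; apply: eq_bigr => k _.
  by rewrite big_mkcond big_ord_recr /= leqNgt ltn_ord addr0 -big_mkcond.
rewrite big_ord_recl big_pred0 ?add0r // -sumrN; apply: eq_bigr => j _.
rewrite -sumrN; apply: eq_big => [k|k]; first by rewrite lift0 -ltnNge.
by rewrite lift0 -ltnNge ltnS => /pair_termN->.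
Qed.

Lemma pair_sumC x y s z : pair_sum x y s z = - pair_sum y x s z.
Proof. by rewrite !pair_sumE opprB. Qed.

Lemma pair_sumxx x s z : pair_sum x x s z = 0.
Proof. by rewrite pair_sumE subrr. Qed.

Definition shift_cons x z k := if k is k'.+1 then z k' else x.

Lemma pfz_cons s x z : pfz s.+1 (shift_cons x z) =
  \sum_(j < s.*2.+1) (-1) ^+ j * (A x (z j) * pfz s (z \o bump j)).
Proof. exact: pfz_expand. Qed.

Lemma pair_sum_cons x y s z : pair_sum x y s z =
  \sum_(j < s.*2.+2) (-1) ^+ j *
    (A x (z j) * pfz s.+1 (shift_cons y (z \o bump j))).
Proof.
apply: eq_bigr => j _; rewrite pfz_cons !mulr_sumr; apply: eq_bigr => k _.
by rewrite /pair_term exprD /=; ring.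
Qed.

Lemma pfz_cons2 s x y z : pfz s.+2 (shift_cons x (shift_cons y z)) =
  A x y * pfz s.+1 z - pair_sum x y s z.
Proof.
rewrite pfz_cons big_ord_recl expr0 mul1r; congr (_ * _ + _).
rewrite pair_sum_cons -sumrN; apply: eq_bigr => j _.
rewrite lift0 exprS mulN1r mulNr; congr (- (_ * (_ * _))).
by apply: eq_pfz => -[|k] //= _; rewrite bumpS.
Qed.

Lemma pfz_xx s x z : pfz s.+1 (shift_cons x (shift_cons x z)) = 0.
Proof.
case: s => [|s]; first by rewrite pfz_cons big_ord1 /= A0 mul0r mulr0.
by rewrite pfz_cons2 A0 pair_sumxx mul0r subr0.
Qed.

(** After the antisymmetry of [pair_sum], row y is expanded first. Its terms with j > 0 keep x, x in
    front and vanish by [pfz_xx]; the term j = 0 cancels the product with [A x y]. *)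
Lemma pfz_xyx s x y z :
  pfz s.+2 (shift_cons x (shift_cons y (shift_cons x z))) = 0.
Proof.
rewrite pfz_cons2 pair_sumC opprK pair_sum_cons big_ord_recl.
rewrite [X in _ + (_ + X)]big1 => [|j _].
  rewrite /= expr0 mul1r addr0 [A y x]AN mulNr; apply/eqP; rewrite subr_eq0.
  by apply/eqP; congr (_ * _); apply: eq_pfz => -[|k].
rewrite lift0 (_ : pfz _ _ = 0) ?mulr0 //.
rewrite -[RHS](pfz_xx s x (z \o bump j)).
by apply: eq_pfz => -[|[|k]] //= _; rewrite bumpS.
Qed.

(* The left-hand side expands a Pfaffian whose index [z d] is repeated. *)
Lemma pfaffian_relation s z d : (d < 2)%N ->
  \sum_(j < s.+1.*2.+1) (-1) ^+ j * (A (z d) (z j) * pfz s.+1 (z \o bump j)) = 0.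
Proof.
rewrite -pfz_cons; case: d => [|[|//]] _.
  rewrite -(pfz_xx s.+1 (z 0) (z \o succn)).
  by apply: eq_pfz => -[|[|k]].
rewrite -(pfz_xyx s (z 1) (z 0) (z \o succn \o succn)).
by apply: eq_pfz => -[|[|[|k]]].
Qed.

End RepeatedIndex.

(** * Initial monomials of sums, and monomials in an initial ideal *)

Section InitialMonomials.

Variables (K : fieldType) (N : nat) (le : rel 'X_{1..N}).
Hypothesis le_term : term_order le.
Implicit Types (f g : {mpoly K[N]}) (m : 'X_{1..N}).

Lemma is_initial_uniq f m m' : is_initial le f m -> is_initial le f m' -> m = m'.
Proof.
case: le_term => _ le_anti _ _ _ [mf fm] [m'f fm'].
by apply: le_anti; rewrite fm' ?fm.
Qed.

Lemma is_initial_sign f m k : is_initial le f m -> is_initial le ((-1) ^+ k * f) m.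
Proof.
rewrite -signr_odd; case: (odd k); rewrite ?expr1 ?mulN1r ?mul1r // => -[mf fm].
by split=> [|m']; rewrite (perm_mem (msuppN _)) => // /fm.
Qed.

Lemma is_initial_MX f m c :
  is_initial le f m -> is_initial le ('X_[c] * f) (c + m)%MM.
Proof.
case: le_term => _ _ _ _ leD [mf fm].
have supp m' : m' \in msupp ('X_[c] * f) -> exists2 k, k \in msupp f & m' = (c + k)%MM.
  by rewrite mulrC (perm_mem (msuppMX _ _)) => /mapP[k kf ->]; exists k.
split=> [|m' /supp[k /fm ? ->]]; last exact: leD.
by rewrite mulrC (perm_mem (msuppMX _ _)); apply/mapP; exists m.
Qed.

Lemma exists_le_max (s : seq 'X_{1..N}) m0 :
  exists2 m, m \in m0 :: s & forall m', m' \in m0 :: s -> le m' m.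
Proof.
case: le_term => le_tot _ le_tr _ _; have le_refl m : le m m by have := le_tot m m; rewrite orbb.
elim: s m0 => [|m1 s IHs] m0; first by exists m0; rewrite ?inE // => m'; rewrite inE => /eqP->.
have [m ms max_m] := IHs m1; have /orP[le0|le0] := le_tot m0 m.
  by exists m => [|m']; rewrite inE ?ms ?orbT // => /predU1P[->|/max_m].
exists m0 => [|m']; rewrite inE ?eqxx // => /predU1P[->//|/max_m le1].
exact: le_tr le1 le0.
Qed.

(** The greatest of the distinct initial monomials occurs in its own summand only, so it cannot
    cancel. *)
Lemma is_initial_sum (I : finType) (P : pred I) (g : I -> {mpoly K[N]})
    (m : I -> 'X_{1..N}) i0 :
    P i0 -> (forall i, P i -> is_initial le (g i) (m i)) -> {in P &, injective m} ->
  exists2 i, P i & is_initial le (\sum_(i | P i) g i) (m i).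
Proof.
move=> Pi0 init_g m_inj; have [_ le_anti le_tr _ _] := le_term.
have [m1 /= m1s max_m1] := exists_le_max [seq m i | i in P] (m i0).
have{m1s} [i Pi m1E] : exists2 i, P i & m1 = m i.
  by move: m1s; rewrite inE => /predU1P[->|/imageP[i Pi ->]]; [exists i0 | exists i].
have{max_m1} max_mi j : P j -> le (m j) (m i).
  by move=> Pj; rewrite -m1E max_m1 // inE image_f ?orbT.
exists i => //; split=> [|m' /msupp_sum_le/flatten_mapP[j]]; last first.
  rewrite mem_filter => /andP[Pj _] m'g.
  by apply: le_tr (max_mi j Pj); apply: (init_g j Pj).2.
rewrite mcoeff_msupp raddf_sum (bigD1 i) //= big1 ?addr0 => [|j /andP[Pj ji]].
  by rewrite -mcoeff_msupp; have [] := init_g i Pi.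
apply/eqP; rewrite mcoeff_eq0; apply: contra ji => mig; apply/eqP/m_inj => //.
by apply: le_anti; rewrite max_mi //; apply: (init_g j Pj).2.
Qed.

(** The monomial must occur in some summand [c * 'X_[m']] of the combination, hence is a multiple of
    [m']. *)
Lemma initial_idealX (S : {mpoly K[N]} -> Prop) m : initial_ideal le S 'X_[m] ->
  exists f m', [/\ S f, is_initial le f m' & (m' <= m)%MM].
Proof.
case=> r [rS XE]; have : m \in msupp ('X_[m] : {mpoly K[N]}) by rewrite msuppX inE.
rewrite XE => /msupp_sum_le/flatten_mapP[[c g]].
rewrite mem_filter /= => /rS[f [m' [/= Sf init_f ->]]] /msuppM_le/allpairsP[[m1 m2] /=].
by rewrite msuppX inE => -[_ /eqP-> ->]; exists f, m'; rewrite lem_addl.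
Qed.

End InitialMonomials.

(** * The variables in the initial monomial of a Pfaffian *)

Section PfaffianInitial.

Variables (K : fieldType) (n : nat).

Lemma skewX_lt (x y : 'I_n) : (x < y)%N ->
  exists2 u : upair n, val u = (x, y) & skewX K n x y = 'X_(enum_rank u).
Proof.
by move=> xy; exists (exist _ (x, y) xy); rewrite // mxE insubT.
Qed.

Lemma skewXN (x y : 'I_n) : skewX K n x y = - skewX K n y x.
Proof.
rewrite !mxE; case: (ltngtP x y) => [xy|yx|/val_inj->].
- by rewrite insubT insubF ?opprK // ltnNge ltnW.
- by rewrite insubF ?insubT // ltnNge ltnW.
- by rewrite !insubF ?oppr0 ?ltnn.
Qed.

Lemma skewXxx (x : 'I_n) : skewX K n x x = 0.
Proof. by rewrite mxE insubF ?ltnn. Qed.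

Lemma skewX_neq (x y : 'I_n) : x != y ->
  exists (u : upair n) (e : nat), skewX K n x y = (-1) ^+ e * 'X_(enum_rank u) /\
    (val u = (x, y) \/ val u = (y, x)).
Proof.
move=> neq; have : (x < y)%N || (y < x)%N by rewrite -neq_ltn.
case/orP=> [/skewX_lt|/skewX_lt] [u uE XE]; exists u.
  by exists 0%N; rewrite mul1r; split; [|left].
by exists 1%N; rewrite mulN1r skewXN XE; split; [|right].
Qed.

Variable le : rel 'X_{1..nvars n}.
Hypothesis le_anti : anti_diagonal K le.

Lemma pf_index_ltn s (b : (s.*2).-tuple 'I_n) k l :
  pf_index b -> (k < l)%N -> (l < s.*2)%N -> (entry b k.+1 < entry b l.+1)%N.
Proof.
case/andP=> _ sb kl ls; apply: (sorted_ltn_nth ltn_trans 0%N sb) => //=;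
  by rewrite inE size_map size_tuple // (ltn_trans kl).
Qed.

Lemma entryE s (b : (s.*2).-tuple 'I_n) (k : 'I_s.*2) : entry b k.+1 = tnth b k.
Proof.
by rewrite /entry (nth_map (tnth b k)) ?size_tuple //= -tnth_nth.
Qed.

Lemma pf_initial s (b : (s.*2).-tuple 'I_n) : pf_index b ->
  exists2 m, is_initial le (pf K b) m &
    forall u : upair n, m (enum_rank u) != 0%N <->
      exists2 k, (k < s)%N & (val u).1 = entry b k.+1 :> nat /\
                          (val u).2 = entry b (s.*2 - k) :> nat.
Proof.
move=> b_idx; have [m init_m mE] := le_anti b_idx; exists m => // u.
pose l (k : 'I_s) := widen_ord (half_subproof s) k.
have /fin_all_exists2[v vE XE] : forall k, exists2 v : upair n,
    val v = (tnth b (l k), tnth b (rev_ord (l k))) &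
    skewX K n (tnth b (l k)) (tnth b (rev_ord (l k))) = 'X_(enum_rank v).
  move=> k; apply: skewX_lt; rewrite -!entryE; apply: pf_index_ltn => //=;
    by have := ltn_ord k; lia.
(* The equality of polynomials determines the exponent vector through the support. *)
have {mE} mE : m = (\sum_(k < s) U_(enum_rank (v k)))%MM.
  apply/eqP; rewrite -(mem_seq1 m) -(msuppX K).
  rewrite (big_morph _ (@mpolyXD _ K) (@mpolyX0 _ K)).
  by under eq_bigr => k _ do rewrite -XE; rewrite -[X in msupp X]mE msuppX inE.
rewrite mE mnm_sumE; split=> [|[k ks [u1 u2]]].
  rewrite sum_nat_eq0 negb_forall => /existsP[k].
  rewrite mnm1E eqb0 negbK => /eqP/enum_rank_inj uE.
  exists k; rewrite // -uE vE /= -!entryE /=; split=> //; congr entry.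
  by have := ltn_ord k; lia.
rewrite sum_nat_eq0 negb_forall; apply/existsP; exists (Ordinal ks).
rewrite mnm1E eqb0 negbK; apply/eqP; congr enum_rank; apply: val_inj; rewrite vE.
case: (val u) u1 u2 => x y /= xE yE; congr pair; apply: val_inj => /=.
  by rewrite xE -entryE.
by rewrite yE -entryE /=; congr entry; lia.
Qed.

End PfaffianInitial.

(** * Combinatorics of the index pairs in the initial monomials *)

Section NatLemmas.

Local Open Scope nat_scope.

Lemma bump_leq j k m : k < m -> bump j k <= m.
Proof. by rewrite /bump; case: (j <= k); lia. Qed.

Lemma finite_choice (P : nat -> nat -> Prop) m :
  (forall k, k < m -> exists y, P k y) ->
  exists f, forall k, k < m -> P k (f k).
Proof.
elim: m => [|m IHm] Pex; first by exists id.
have [f fP] := IHm (fun k km => Pex k (ltnW km)); have [y Py] := Pex m (ltnSn m).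
exists (fun k => if k == m then y else f k) => k; rewrite ltnS leq_eqVlt.
by case: eqP => [-> //|_ /= /fP].
Qed.

Lemma mono_gap (f : nat -> nat) m k l :
  (forall k l, k < l -> l < m -> f k < f l) -> k <= l < m ->
  f k + (l - k) <= f l.
Proof.
move=> f_mono; elim: l => [|l IHl] /andP[kl lm]; first by case: k kl => //; rewrite addn0.
case: (ltngtP k l.+1) kl => // [kl _|-> _]; last by rewrite subnn addn0.
have := f_mono l l.+1 (ltnSn l) lm; have := IHl; rewrite -ltnS kl ltnW //; lia.
Qed.

Section NestedPairs.

Variables (s : nat) (z : nat -> nat).
Hypothesis z_mono : forall k l, k < l -> l <= s.*2 -> z k < z l.

Lemma increasing_inj k l : k <= s.*2 -> l <= s.*2 -> z k = z l -> k = l.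
Proof.
move=> ks ls; case: (ltngtP k l) => // kl.
  by have := z_mono kl ls; lia.
by have := z_mono kl ks; lia.
Qed.

Lemma increasing_ltn k l : k <= s.*2 -> z k < z l -> k < l.
Proof.
move=> ks; case: (ltngtP k l) => // [lk|->]; last by rewrite ltnn.
by have := z_mono lk ks; lia.
Qed.

Lemma increasing_leq k l : k <= l -> l <= s.*2 -> z k <= z l.
Proof. by rewrite leq_eqVlt => /predU1P[->|kl ls] //; apply/ltnW/z_mono. Qed.

Variables i d : nat.
Hypotheses (d2 : d < 2) (i2 : 2 <= i) (odd_i : odd i = d :> nat).
Hypothesis sE : s.*2 = (i + d).+2.

(* The pairs x, y such that X_(x y) or X_(y x) occurs in the initial monomial of
   X_(z_d z_j) [z_0, .., z_(j-1), z_(j+1), .., z_2s]. *)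
Definition lead_pair j x y : Prop :=
  [\/ x = z d /\ y = z j, x = z j /\ y = z d |
      exists2 k, k < s & x = z (bump j k) /\ y = z (bump j (s.*2 - k.+1))].

(** This separates the initial monomials of the terms of F. Nested pairs in Z without z_j' have
    positions of sum 2s - 1 = i + d + 1, whereas z_d and z_j sit at positions at most d and i. *)
Lemma lead_pair_inj j j' : j <= i -> j' <= i -> j != d -> j' != d ->
  lead_pair j' (z d) (z j) \/ lead_pair j' (z j) (z d) -> j = j'.
Proof.
move=> ji ji' jd jd'.
have zE k l : k <= s.*2 -> l <= s.*2 -> z k = z l -> k = l by exact: increasing_inj.
have no_pair k l : k + l = s.*2.-1 ->
    z (bump j' k) = z d -> z (bump j' l) = z j -> False.
  move=> kl /zE E1 /zE E2.
  have {}E1 : bump j' k = d by apply: E1; rewrite ?bump_leq //; lia.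
  have {}E2 : bump j' l = j by apply: E2; rewrite ?bump_leq //; lia.
  by move: E1 E2; rewrite /bump; case: (j' <= k); case: (j' <= l); lia.
case=> [] [[]|[]|[k ks []]].
- by move=> _ /zE; apply; lia.
- by move=> /zE dj'; lia.
- by move=> /esym E1 /esym E2; case: (no_pair _ _ _ E1 E2); lia.
- by move=> /zE; lia.
- by move=> /zE + _; apply; lia.
by move=> /esym E1 /esym E2; case: (no_pair _ _ _ E2 E1); lia.
Qed.

Variable a : nat -> nat.
Hypothesis z_a : forall k, k < i -> z k = a k.
Hypothesis zS_a : forall k, i <= k -> k < s.*2 -> z k.+1 = a k.

(** The last hypothesis is what divisibility by the initial monomial of [b] provides; the conclusion
    makes b no natural generator. *)
Lemma lead_pair_ge s' (b : nat -> nat) j :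
  j <= i -> j != d ->
  (forall k l, k < l -> l < s'.*2 -> b k < b l) ->
  (forall k, k < s' -> lead_pair j (b k) (b (s'.*2 - k.+1))) ->
  s' <= s /\ forall k, k < s'.*2 -> a k <= b k.
Proof.
move=> ji jd b_mono b_lead.
(* [f k] is the position of b_k in Z. *)
have [f fP] : exists f, forall k, k < s'.*2 -> f k <= s.*2 /\ b k = z (f k).
  apply: (finite_choice (P := fun k y => y <= s.*2 /\ b k = z y)) => k ks.
  have z_lead x y : lead_pair j x y ->
      (exists2 l, l <= s.*2 & x = z l) /\ (exists2 l, l <= s.*2 & y = z l).
    case=> [[-> ->]|[-> ->]|[l ls [-> ->]]]; split; try by eexists; last reflexivity; lia.
      by exists (bump j l); rewrite ?bump_leq //; lia.
    by exists (bump j (s.*2 - l.+1)); rewrite ?bump_leq //; lia.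
  have [ks'|ks'] := ltnP k s'.
    by have [[l ls bE] _] := z_lead _ _ (b_lead k ks'); exists l.
  have ks2 : s'.*2 - k.+1 < s' by lia.
  have [_ [l ls bE]] := z_lead _ _ (b_lead _ ks2); exists l; split=> //.
  by rewrite -bE; congr b; lia.
have f_mono k l : k < l -> l < s'.*2 -> f k < f l.
  move=> kl ls; have := b_mono k l kl ls.
  have [|fk ->] := fP k; first lia; have [fl ->] := fP l ls.
  exact: increasing_ltn.
have f_ge k : k < s'.*2 -> k <= f k.
  by move=> ks; have := mono_gap (k := 0) (l := k) f_mono; lia.
have s's : s' <= s.
  case: (posnP s') => [-> //|s'0].
  have ks : s'.*2.-1 < s'.*2 by lia.
  by have := f_ge _ ks; have [] := fP _ ks; lia.
(* Since z_k = a_k for k < i and z_(k+1) = a_k for k >= i, an inequality b_k < a_k forces k >= i and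
   [f k = k]. *)
split=> // k ks; rewrite leqNgt; apply/negP=> bk_lt.
have [fk bE] := fP k ks; have fk_ge := f_ge k ks.
have ik : i <= k.
  rewrite leqNgt; apply/negP=> ki; move: bk_lt.
  by rewrite bE -z_a // ltnNge increasing_leq.
have fkE : f k = k.
  apply/eqP; rewrite eqn_leq fk_ge andbT -ltnS ltnNge; apply/negP=> lt_fk.
  have ks2 : k < s.*2 by lia.
  by move: bk_lt; rewrite bE -zS_a // ltnNge increasing_leq //; lia.
(* As [f] grows by at least one per step, [f k = k] makes it the identity up to k. *)
have bz l : l <= k -> b l = z l.
  move=> lk; have ls : l < s'.*2 by lia.
  have [_ ->] := fP l ls; congr z; have := f_ge l ls.
  by have := mono_gap (k := l) (l := k) f_mono; lia.
have ps : s'.*2 - i.+1 < s' by lia.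
have := b_lead _ ps.
have -> : s'.*2 - (s'.*2 - i.+1).+1 = i by lia.
rewrite !bz; try lia.
set p := s'.*2 - i.+1.
have pd : p <> d by rewrite /p; have := odd_double_half i; lia.
have p_le : p <= d.+1 by rewrite /p; lia.
have pi : p < i by lia.
(* A pair containing z_d would need p = d or i = d. In a nested pair, j < i puts c at position i - 1
   once z_j is deleted, so its partner is at position d + 2, beyond p. *)
case=> [[/increasing_inj E _]|[_ /increasing_inj E]|[l ls [/increasing_inj E1 /increasing_inj E2]]]; try lia.
have {}E1 : p = bump j l by apply: E1; rewrite ?bump_leq //; lia.
have {}E2 : i = bump j (s.*2 - l.+1) by apply: E2; rewrite ?bump_leq //; lia.
move: E1 E2; rewrite /bump; case: leqP; case: leqP; lia.
Qed.

End NestedPairs.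

End NatLemmas.

(** * The element F and the proof of the theorem *)

Lemma ideal_gen_sum (K : fieldType) N (S : {mpoly K[N]} -> Prop) (I : finType)
    (P : pred I) (c g : I -> {mpoly K[N]}) :
  (forall i, P i -> S (g i)) -> ideal_gen S (\sum_(i | P i) c i * g i).
Proof.
move=> Sg; exists [seq (c i, g i) | i <- enum P]; split=> [_ /mapP[i iP ->]|].
  by apply: Sg; rewrite mem_enum in iP.
by rewrite big_map big_enum.
Qed.

Lemma pf_pfz (K : fieldType) n s (z : nat -> 'I_n) :
  pf K [tuple z k | k < s.*2] = pfz (skewX K n) s z.
Proof.
by congr pfaffian; apply/matrixP=> k l; rewrite [LHS]mxE [RHS]mxE !tnth_mktuple.
Qed.

Theorem proposition2p9 (K : fieldType) (n : nat)
    (le : rel 'X_{1..nvars n})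
    (le_term : term_order le) (le_anti : anti_diagonal K le)
    (t : nat) (a : (t.*2).-tuple 'I_n) (a_idx : pf_index a)
    (i : nat) (i_gap : is_first_gap a i) (i_lt : (i < t.*2 - 1)%N) :
  ~ groebner_basis le (cogen (K := K) a) (ideal_gen (cogen (K := K) a)).
Proof.
have [i2 /andP[_ gap_i] _] := i_gap.
have {i_gap gap_i} ai_lt : ((entry a i).+1 < entry a i.+1)%N.
  by case/orP: gap_i => // /eqP iE; lia.
pose d : nat := odd i; pose s := ((i + d).+2)./2.
have d2 : (d < 2)%N by rewrite /d; case: (odd i).
have sE : s.*2 = (i + d).+2.
  by rewrite /s /d; have := odd_double_half i; lia.
(* From i < 2t - 1 one gets i + 2 <= 2t, and i + 3 <= 2t by parity when i is odd. *)
have st : (s <= t)%N by move: sE; rewrite /d; have := odd_double_half i; lia.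
pose zn k := if (k < i)%N then entry a k.+1
             else if k == i then (entry a i).+1 else entry a k.
have a_mono k l : (k < l)%N -> (l < t.*2)%N -> (entry a k.+1 < entry a l.+1)%N.
  exact: pf_index_ltn.
have zn_a k : (k < i)%N -> zn k = entry a k.+1 by rewrite /zn => ->.
have zn_i : zn i = (entry a i).+1 by rewrite /zn ltnn eqxx.
have znS k : (i <= k)%N -> (k < s.*2)%N -> zn k.+1 = entry a k.+1.
  by move=> ik _; rewrite /zn ltnNge leqW // gtn_eqF.
have zn_mono k l : (k < l)%N -> (l <= s.*2)%N -> (zn k < zn l)%N.
  move=> kl ls; have [li|il|li] := ltngtP l i; last 1 first.
  - rewrite {}li in kl *; rewrite zn_i zn_a // ltnS.
    have [->//|ki] := eqVneq k.+1 i; have iE : i = i.-1.+1 by lia.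
    by rewrite iE; apply/ltnW/a_mono; lia.
  - by rewrite !zn_a ?a_mono //; lia.
  case: l kl ls il => // l kl ls il.
  rewrite (znS l) //; have [ki|ik|->] := ltngtP k i.
  - by rewrite zn_a ?a_mono //; lia.
  - by case: k ik kl => // k ik kl; rewrite znS ?a_mono //; lia.
  rewrite zn_i; move: il; rewrite ltnS leq_eqVlt => /predU1P[<-//|il].
  by apply: ltn_trans ai_lt _; apply: a_mono; lia.
have t0 : (0 < t.*2)%N by lia.
have zn_n k : (k <= s.*2)%N -> (zn k < n)%N.
  move=> ks; have : (zn s.*2 < n)%N.
    have -> : s.*2 = (s.*2.-1).+1 by lia.
    rewrite znS; try lia.
    have hs : (s.*2.-1 < t.*2)%N by lia.
    by rewrite (entryE a (Ordinal hs)) ltn_ord.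
  by move: ks; rewrite leq_eqVlt => /predU1P[->//|/zn_mono/(_ (leqnn _))]; apply: ltn_trans.
(* The default value is taken only at positions beyond 2s, which never matter. *)
pose z k : 'I_n := insubd (tnth a (Ordinal t0)) (zn k).
have zE k : (k <= s.*2)%N -> z k = zn k :> nat by move=> /zn_n ks; rewrite val_insubd ks.
pose Z j := [tuple z (bump j k) | k < s.*2].
have entry_Z j k : (k < s.*2)%N -> entry (Z j) k.+1 = zn (bump j k).
  by move=> ks; rewrite (entryE _ (Ordinal ks)) tnth_mktuple zE // bump_leq.
have Z_idx j : pf_index (Z j).
  apply/andP; split; first lia.
  apply/(sortedP 0%N) => k; rewrite size_map size_tuple => ks.
  have := entry_Z j k; have := entry_Z j k.+1; rewrite /entry /= => -> // -> //; last lia.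
  by apply: zn_mono; rewrite ?bump_leq //; rewrite /bump; case: (leqP j k); case: leqP; lia.
pose h (j : 'I_s.*2.+1) := (-1) ^+ j * (skewX K n (z d) (z j) * pf K (Z j)).
pose P (j : 'I_s.*2.+1) := (j <= i)%N && (nat_of_ord j != d).
have h_rel : \sum_j h j = 0.
  have [s0 s0E] : exists s0, s = s0.+1 by exists s.-1; lia.
  rewrite -[RHS](pfaffian_relation (@skewXxx K n) (@skewXN K n) s0 z d2).
  rewrite -s0E; apply: eq_bigr => j _.
  by rewrite /h /Z (pf_pfz K s (z \o bump j)).
have F_in : ideal_gen (cogen (K := K) a) (\sum_(j | P j) h j).
  (* By the relation, F is minus the sum of the terms with j > i; the term j = d is zero because X
     has zero diagonal. *)
  have -> : \sum_(j | P j) h j =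
      \sum_(j : 'I_s.*2.+1 | (i < j)%N) (- ((-1) ^+ j * skewX K n (z d) (z j))) * pf K (Z j).
    apply/eqP; rewrite -subr_eq0 -sumrN; apply/eqP.
    apply: etrans h_rel; rewrite [RHS](bigID P) /=.
    congr (_ + _); rewrite big_mkcond [RHS]big_mkcond; apply: eq_bigr => j _.
    rewrite /P /h mulNr opprK mulrA ltnNge; case: (j <= i)%N => //=.
    by case: eqP => //= ->; rewrite skewXxx mulr0 mul0r.
  apply: ideal_gen_sum => j ij; exists s, (Z j); split=> // -[_ /(_ i.+1)].
  rewrite entry_Z; last lia.
  by rewrite /bump (leqNgt j) ij add0n zn_i => /(_ _); lia.
(* The condition [P j] stands under the existential so that [m] can be chosen for all [j] at once,
   with 0 outside [P]. *)
have lead_h (j : 'I_s.*2.+1) : exists m, P j ->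
    [/\ is_initial le (h j) m,
     forall u : upair n, m (enum_rank u) != 0%N -> lead_pair s zn d j (val u).1 (val u).2
   & exists2 u : upair n, m (enum_rank u) != 0%N &
       (val u = (z d, z j) \/ val u = (z j, z d))].
  have [Pj|] := boolP (P j); last by exists 0%MM.
  have js : (j <= s.*2)%N by rewrite -ltnS.
  have [|u0 [e [XE u0E]]] := @skewX_neq K n (z d) (z j).
    case/andP: Pj => ji jd; rewrite -val_eqE /= !zE //; last lia.
    by apply: contra jd => /eqP/(increasing_inj zn_mono) dj; apply/eqP; rewrite dj //; lia.
  have [m init_m mP] := pf_initial le_anti (Z_idx j).
  exists (U_(enum_rank u0) + m)%MM => _; split.
  - rewrite /h XE -mulrA; do 2 apply: is_initial_sign => //.
    exact: is_initial_MX.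
  - move=> u; rewrite mnmDE mnm1E addn_eq0 negb_and eqb0 negbK.
    case/orP=> [/eqP/enum_rank_inj <-|/mP[k ks [-> ->]]].
      by case: u0E => -> /=; rewrite !zE ?js //; [constructor 1|lia|constructor 2|lia].
    constructor 3; exists k; rewrite // entry_Z; last lia.
    rewrite (_ : s.*2 - k = (s.*2 - k.+1).+1)%N; last lia.
    by rewrite entry_Z //; lia.
  by exists u0; rewrite // mnmDE mnm1E eqxx.
have [m mP] := fin_all_exists lead_h.
(* The element of {0, 1} other than d: F has at least one term. *)
pose j0 : 'I_s.*2.+1 := inord (1 - d).
have Pj0 : P j0 by rewrite /P inordK; lia.
have m_inj : {in P &, injective m}.
  move=> j j' Pj Pj' mE; apply: val_inj.
  have [_ _ [u mu uE]] := mP j Pj.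
  have [_ /(_ u) lead_j' _] := mP j' Pj'; rewrite -mE in lead_j'.
  case/andP: Pj => ji jd; case/andP: Pj' => ji' jd'.
  have js : (j <= s.*2)%N by rewrite -ltnS.
  have ds : (d <= s.*2)%N by lia.
  apply: (lead_pair_inj zn_mono d2 i2 erefl sE) => //.
  by case: uE (lead_j' mu) => -> /=; rewrite !zE //; [left|right].
have init_h j : P j -> is_initial le (h j) (m j) by case/mP.
have [j Pj init_F] := is_initial_sum le_term Pj0 init_h m_inj.
(* The initial monomial of F is in the initial ideal of the cogenerated ideal; a Gröbner basis would
   also put it in that of the generators. *)
case=> _ /(_ 'X_[m j])[_ []].
  exists [:: (1, 'X_[m j])]; split; last by rewrite big_seq1 mul1r.
  by move=> _ /[!inE]/eqP->; exists (\sum_(k | P k) h k), (m j).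
move=> r rP.
have [f [m' [[s' [b [b_idx b_nge ->]]] init_b m'_le]]] :=
  initial_idealX (ex_intro _ r rP).
have [m'' init_m'' m''P] := pf_initial le_anti b_idx.
have m''E := is_initial_uniq le_term init_m'' init_b; rewrite {m'' init_m''}m''E in m''P.
apply: b_nge; have [_ lead_j _] := mP j Pj; case/andP: Pj => ji jd.
have b_mono k l : (k < l)%N -> (l < s'.*2)%N -> (entry b k.+1 < entry b l.+1)%N.
  exact: pf_index_ltn.
(* The first goal is the pair hypothesis: a variable of the initial monomial of [b] divides [m j],
   so its indices form a [lead_pair]. *)
have [k ks'|s's b_ge] := lead_pair_ge zn_mono d2 i2 erefl sE zn_a znS ji jd b_mono.
  have k1 : (k < s'.*2)%N by lia.
  have k2 : (s'.*2 - k.+1 < s'.*2)%N by lia.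
  have b_lt : (tnth b (Ordinal k1) < tnth b (Ordinal k2))%N.
    by rewrite -!entryE b_mono //=; lia.
  pose u : upair n := exist _ (tnth b (Ordinal k1), tnth b (Ordinal k2)) b_lt.
  have := lead_j u; rewrite /= -!entryE /=; apply.
  have : m' (enum_rank u) != 0%N.
    apply/m''P; exists k; rewrite //= -!entryE /=; split=> //; congr entry; lia.
  by rewrite -!lt0n => /leq_trans; apply; apply: (mnm_lepP m'_le).
split; first exact: leq_trans st.
by case=> // k /andP[_ ks]; apply: b_ge.
Qed.
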